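(* Let $(\alpha_n(a,k),\beta_n(a,k))_{n\ge0}$ be a family of sequences, depending on parameters $a,k$, satisfying for all $a,k$ and all $n\ge0$ \[ \beta_{n}(a,k) = \sum_{j=0}^{n}\frac{(k/a;q)_{n-j}(k;q)_{n+j}}{(q;q)_{n-j}(aq;q)_{n+j}}\alpha_{j}(a,k). \] Let $(g_n)_{n\ge0}$ be an arbitrary sequence and $c,e$ arbitrary constants. Define \[ \alpha_n'(a,k) = g_n\alpha_n(e,c), \] \[ \beta_{n}'(a,k)= \sum_{j=0}^{n}\beta_{j}(e,c)\frac{(1-c q^{2j})(k/a;q)_{n-j}(k;q)_{n+j}(eq;q)_{2j}}{(1-c)(q;q)_{n-j}(aq;q)_{n+j}(cq;q)_{2j}} \sum_{r=0}^{n-j}\frac{(1-eq^{2j+2r})(q^{-(n-j)},kq^{n+j},e/c,eq^{2j};q)_r}{(1-e q^{2j})(a q^{n+j+1},a q^{1-(n-j)}/k,cq^{2j+1},q;q)_r}\left(\frac{q a c}{k e} \right)^r g_{r+j}. \] Then $(\alpha_n'(a,k),\beta_n'(a,k))$ satisfies the same relation, i.e. $\beta_n'(a,k)=\sum_{j=0}^{n}\frac{(k/a;q)_{n-j}(k;q)_{n+j}}{(q;q)_{n-j}(aq;q)_{n+j}}\alpha_j'(a,k)$ for all $n\ge0$.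
   Context: $(x;q)_n=\prod_{i=0}^{n-1}(1-xq^i)$ and $(x_1,\dots,x_m;q)_n=(x_1;q)_n\cdots(x_m;q)_n$. All parameters are generic so that denominators are nonzero. *)

(* Defs.v *)
From mathcomp Require Import all_boot all_order all_algebra.

Set Implicit Arguments.
Unset Strict Implicit.
Unset Printing Implicit Defensive.

Import GRing.Theory.
Local Open Scope ring_scope.

Definition qpoch (F : fieldType) (q x : F) (n : nat) : F :=
  \prod_(i < n) (1 - x * q ^+ i).

Definition qpochs (F : fieldType) (q : F) (xs : seq F) (n : nat) : F :=
  \prod_(x <- xs) qpoch q x n.

Definition bailey_relation (F : fieldType) (q a k : F) (alpha beta : nat -> F)
    : Prop :=
  forall n : nat,
    beta n = \sum_(j < n.+1)
      qpoch q (k / a) (n - j) * qpoch q k (n + j)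
      / (qpoch q q (n - j) * qpoch q (a * q) (n + j)) * alpha j.

(* Genericity of [a] and [k] in [bailey_relation]: together with the
   nonvanishing of (q;q)_n, assumed separately, it makes all the denominators
   of that relation nonzero.  No condition falls on [k]. *)
Definition bailey_generic (F : fieldType) (q a : F) : Prop :=
  a != 0 /\ (forall n : nat, qpoch q (a * q) n != 0).

Definition alpha' (F : fieldType) (g : nat -> F) (c e : F)
    (alpha : F -> F -> nat -> F) : F -> F -> nat -> F :=
  fun a k n => g n * alpha e c n.

Definition beta' (F : fieldType) (q : F) (g : nat -> F) (c e : F)
    (beta : F -> F -> nat -> F) : F -> F -> nat -> F :=
  fun a k n =>
    \sum_(j < n.+1)
      beta e c j
      * ((1 - c * q ^+ (2 * j)) * qpoch q (k / a) (n - j) * qpoch q k (n + j)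
           * qpoch q (e * q) (2 * j)
         / ((1 - c) * qpoch q q (n - j) * qpoch q (a * q) (n + j)
              * qpoch q (c * q) (2 * j)))
      * \sum_(r < (n - j).+1)
          (1 - e * q ^+ (2 * j + 2 * r))
            * qpochs q [:: q ^- (n - j); k * q ^+ (n + j); e / c;
                           e * q ^+ (2 * j)] r
          / ((1 - e * q ^+ (2 * j))
             * qpochs q [:: a * q ^+ (n + j + 1);
                            a * q ^ (1 - (n - j)%N%:Z) / k;
                            c * q ^+ (2 * j + 1); q] r)
          * (q * a * c / (k * e)) ^+ r * g (r + j)%N.

(* Main.v *)
Require Import Defs.
From mathcomp Require Import all_boot all_order all_algebra.
From mathcomp Require Import ring.

Set Implicit Arguments.
Unset Strict Implicit.
Unset Printing Implicit Defensive.

Import GRing.Theory.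
Local Open Scope ring_scope.

(** After exchanging the two sums in [beta' n], the coefficient of
    [beta j * g s] factors as [bailey_inverse s j * bailey_matrix n s], where
    the second factor is the [(n, s)] entry of the Bailey matrix in [(a, k)] and
    the first depends only on [(e, c)].  So the theorem amounts to the inversion
    [alpha s = \sum_j bailey_inverse s j * beta j] of the Bailey matrix in
    [(e, c)].  The orthogonality of the two matrices is a terminating
    very-well-poised 6phi5 sum whose parameters [a; b, c, d] satisfy [a = bcd];
    in that case even the partial sums are products, and the sum telescopes. *)

(** Both sides run over the triangle [j + r <= n], the right one by antidiagonals [s = j + r].
    Passing to [n.+1] adds exactly the antidiagonal [s = n.+1]. *)
Lemma big_triangle (V : nmodType) (n : nat) (f : nat -> nat -> V) :
  \sum_(j < n.+1) \sum_(r < (n - j).+1) f j r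
  = \sum_(s < n.+1) \sum_(j < s.+1) f j (s - j)%N.
Proof.
elim: n => [|n IHn]; first by rewrite !big_ord1.
rewrite [RHS]big_ord_recr -IHn /= big_ord_recr /= subnn big_ord1.
rewrite [X in _ = _ + X]big_ord_recr /= subnn addrA -big_split /=.
congr (_ + _); apply: eq_bigr => j _.
by rewrite subSn ?big_ord_recr // -ltnS.
Qed.

(** * Splitting and reversal of q-shifted factorials *)

Section QPochhammer.
Variables (F : fieldType) (q : F).
Implicit Types (x : F) (m n : nat).

Lemma qpoch0 x : qpoch q x 0 = 1.
Proof. by rewrite /qpoch big_ord0. Qed.

Lemma qpochS x n : qpoch q x n.+1 = qpoch q x n * (1 - x * q ^+ n).
Proof. by rewrite /qpoch big_ord_recr. Qed.

Lemma qpochD x m n : qpoch q x (m + n) = qpoch q x m * qpoch q (x * q ^+ m) n.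
Proof.
elim: n => [|n IHn]; first by rewrite addn0 qpoch0 mulr1.
by rewrite addnS !qpochS IHn -!mulrA exprD.
Qed.

Lemma qpochSl x n : qpoch q x n.+1 = (1 - x) * qpoch q (x * q) n.
Proof. by rewrite -add1n qpochD qpochS qpoch0 expr0 mulr1 mul1r expr1. Qed.

Lemma qpoch_factor_neq0 x n : qpoch q x n.+1 != 0 -> 1 - x * q ^+ n != 0.
Proof. by rewrite qpochS mulf_eq0 negb_or => /andP[]. Qed.

Lemma qpoch_shift_neq0 x m :
  (forall n, qpoch q x n != 0) -> forall n, qpoch q (x * q ^+ m) n != 0.
Proof.
by move=> hx n; move: (hx (m + n)%N); rewrite qpochD mulf_eq0 negb_or => /andP[].
Qed.

(* The power of [q] common to both reversals, [q^{r(r-1)/2 - Nr}], has been cancelled. *)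
Lemma qpoch_rev_ratio x N r : q != 0 -> x != 0 -> (r <= N)%N ->
  qpoch q (x * q ^ (1 - N%:Z)) r * qpoch q x^-1 (N - r) * qpoch q q N
  = qpoch q (q ^- N) r * qpoch q q (N - r) * qpoch q x^-1 N * (x * q) ^+ r.
Proof.
move=> q0 x0; elim: r => [|r IHr] lerN.
  by rewrite !qpoch0 subn0 expr0 mulr1 !mul1r mulrC.
have {IHr} := IHr (ltnW lerN).
have eN : (N - r)%N = (N - r.+1).+1 by rewrite subnSK.
set p := (N - r.+1)%N in eN *.
have -> : N = (r + p.+1)%N by rewrite -eN subnKC // ltnW.
have -> : (r + p.+1 - r)%N = p.+1 by rewrite addKn.
have -> : q ^ (1 - (r + p.+1)%N%:Z) = q ^- (r + p).
  by rewrite addnS -addn1 PoszD opprD addrCA subrr addr0 -exprnN.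
rewrite !(qpochS _ p) !(qpochS _ r) => IHr.
have qr : q ^+ r != 0 by rewrite expf_neq0.
have qp : q ^+ p != 0 by rewrite expf_neq0.
(* Up to a monomial, the factor gained by the growing product is the one lost by the shrinking
   product; likewise for the base [q] below. *)
have -> : 1 - x * q ^- (r + p) * q ^+ r = - x / q ^+ p * (1 - x^-1 * q ^+ p).
  by rewrite exprD; field; rewrite x0 qp qr.
have -> : 1 - q ^- (r + p.+1) * q ^+ r = - (q * q ^+ p)^-1 * (1 - q * q ^+ p).
  by rewrite exprD exprS; field; rewrite q0 qp qr.
transitivity (- x / q ^+ p * (qpoch q q (r + p.+1)
  * qpoch q (x * q ^- (r + p)) r * qpoch q x^-1 p * (1 - x^-1 * q ^+ p))).
  by ring.
rewrite (_ : qpoch q q _ * _ * _ * _ = qpoch q (x * q ^- (r + p)) r *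
  (qpoch q x^-1 p * (1 - x^-1 * q ^+ p)) * qpoch q q (r + p.+1)); last by ring.
by rewrite IHr exprS; field; rewrite q0 qp.
Qed.

End QPochhammer.

(** * A telescoping very-well-poised sum *)

Section Telescope.
Variables (F : fieldType) (q E x : F).
Hypotheses (hq : forall n, qpoch q q n != 0) (x0 : x != 0)
  (hE : forall n, qpoch q (E * q) n != 0)
  (hC : forall n, qpoch q (x * E * q) n != 0).

(** The part depending on [t] of a product of entries of the two matrices, with
    [E = e * q ^+ (2 * i)] and [x = c / e]. *)
Definition bressoud_term (m t : nat) : F :=
  (1 - x * E * q ^+ (2 * t)) * qpoch q x t * qpoch q (x * E) t
  * qpoch q x^-1 (m - t) * x ^+ (m - t) * qpoch q E (m + t)
  / (qpoch q q t * qpoch q (E * q) t * qpoch q q (m - t)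
     * qpoch q (x * E * q) (m + t)).

(* The 6phi5 sum with parameters [xE; x, E q^(m+1), q^(-m-1)]. *)
Lemma bressoud_partial_sum m n : (n <= m)%N ->
  \sum_(t < n.+1) bressoud_term m.+1 t
  = (x - 1) * (x ^+ (m - n) * qpoch q (x * q) n * qpoch q (x * E) n.+1
       * qpoch q (x^-1 * q) (m - n) * qpoch q E (m.+1 + n.+1))
    / (qpoch q q n * qpoch q (E * q) n * qpoch q q (m - n)
       * qpoch q (x * E * q) (m.+1 + n)
       * (1 - E * q ^+ m.+1) * (1 - q ^+ m.+1)).
Proof.
have hq1 i : 1 - q ^+ i.+1 != 0 by rewrite exprS qpoch_factor_neq0.
have hE1 i : 1 - E * q ^+ i.+1 != 0 by rewrite exprS mulrA qpoch_factor_neq0.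
have hC1 i : 1 - x * E * q ^+ i.+1 != 0.
  by rewrite exprS mulrA qpoch_factor_neq0.
elim: n => [|n IHn] lenm.
  (* The prefactor [x - 1] of the closed form arises here as [x * (1 - x^-1)]. *)
  rewrite big_ord1 /bressoud_term !subn0 !addn0 muln0 !qpoch0 addn1.
  rewrite (qpochS _ _ m.+1) (qpochS q q) (qpochSl _ x^-1) (exprS x).
  rewrite (qpochS _ _ 0) qpoch0 expr0 !mulr1.
  move: (hq1 m) (hE1 m); rewrite !exprS => hqm hEm.
  by field; rewrite x0 hqm hEm hC hq.
rewrite big_ord_recr /= IHn ?(ltnW lenm) // /bressoud_term.
(* With [p = m - n.+1] all lengths become sums, and unrolling to common lengths leaves a rational
   identity. *)
have [p ->] : exists p, m = (n + p).+1.
  by exists (m - n.+1)%N; rewrite -addSn subnKC.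
rewrite !subSS.
have -> : ((n + p).+1 - n = p.+1)%N by rewrite subSn ?leq_addr // addKn.
rewrite addKn.
have := hq1 n; have := hq1 p; have := hE1 n; have := hE1 (n + p).+1.
have := hq1 (n + p).+1; have := hC1 ((n + p).+2 + n)%N.
have := hq n; have := hq p; have := hE n; have := hC ((n + p).+2 + n)%N.
rewrite !(addnS (n + p).+2) (qpochSl _ x n) (qpochSl _ x^-1 p).
rewrite (qpochS _ E (_ + _).+1) (qpochS _ (x * E) n.+1) !(qpochS _ _ n) !(qpochS _ _ p).
rewrite (qpochS _ (x * E * q)).
rewrite !addSn mulnS mul2n -addnn !(exprS, exprD).
rewrite expr0 => h1 h2 h3 h4 h5 h6 h7 h8 h9 h10; field.
rewrite x0; move: h1 h2 h3 h4 h5 h6 h7 h8 h9 h10; rewrite -!mulrA.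
by do 10!move->.
Qed.

(** The closed form at [n = m] is the opposite of the one remaining term, [t = m.+1]. *)
Lemma bressoud_sum m : \sum_(t < m.+2) bressoud_term m.+1 t = 0.
Proof.
rewrite big_ord_recr /= bressoud_partial_sum // /bressoud_term !subnn !qpoch0.
rewrite !(addnS, addSn) (qpochSl _ x) (qpochS _ q) (qpochS _ (E * q)).
rewrite (qpochS _ (x * E * q) (m + m).+1) mulnS mul2n -addnn.
have := hq m.+1; have := hE m.+1; have := hC (m + m).+2.
rewrite (qpochS _ (x * E * q) (m + m).+1) !(qpochS _ _ m) !mulf_eq0.
rewrite !negb_or !(exprS, exprD) => /andP[h1 h2].
move=> /andP[h3 h4] /andP[h5 h6].
field; move: h1 h2 h3 h4 h5 h6; rewrite -!mulrA.
by do 6!move->.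
Qed.
End Telescope.

(** * Inversion of the Bailey matrix *)

Section Inversion.
Variables (F : fieldType) (q c e : F).
Hypotheses (hq : forall n, qpoch q q n != 0) (c0 : c != 0) (e0 : e != 0)
  (c1 : 1 - c != 0) (e1 : 1 - e != 0)
  (hc : forall n, qpoch q (c * q) n != 0)
  (he : forall n, qpoch q (e * q) n != 0).

(* Here [c] and [e] stand in the places of [k] and [a] in [bailey_relation]. *)
Definition bailey_matrix (n j : nat) : F :=
  qpoch q (c / e) (n - j) * qpoch q c (n + j)
  / (qpoch q q (n - j) * qpoch q (e * q) (n + j)).

Definition bailey_inverse (n j : nat) : F :=
  (1 - c * q ^+ (2 * j)) * (1 - e * q ^+ (2 * n)) * qpoch q e (n + j)
  * qpoch q (e / c) (n - j) * (c / e) ^+ (n - j)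
  / ((1 - c) * (1 - e) * qpoch q (c * q) (n + j) * qpoch q q (n - j)).

Let mulf_div_shift y : c / e * (e * y) = c * y.
Proof. by rewrite mulrA divfK. Qed.

(** Splitting off the first [2 * i] factors of each long factorial isolates the dependence on
    [t]. *)
Lemma bailey_inverse_term i m t :
  bailey_inverse (i + m) (i + t) * bailey_matrix (i + t) i
  = (1 - e * q ^+ (2 * (i + m))) * qpoch q e (2 * i) * qpoch q c (2 * i)
    / ((1 - c) * (1 - e) * qpoch q (c * q) (2 * i) * qpoch q (e * q) (2 * i))
    * bressoud_term q (e * q ^+ (2 * i)) (c / e) m t.
Proof.
rewrite /bailey_inverse /bailey_matrix /bressoud_term subnDl addKn.
have -> : (i + m + (i + t) = 2 * i + (m + t))%N by rewrite addnACA addnn mul2n.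
have -> : (i + t + i = 2 * i + t)%N by rewrite addnAC addnn mul2n.
have hcs := qpoch_shift_neq0 (2 * i) hc; have hes := qpoch_shift_neq0 (2 * i) he.
rewrite !(qpochD _ _ (2 * i)) invf_div mulnDr exprD mulf_div_shift // [in LHS]mulrA.
rewrite ![_ * q ^+ (2 * i) * q]mulrAC.
by field; rewrite !hq c1 e1 hc he hcs hes.
Qed.

Lemma bailey_inverseK i m :
  \sum_(t < m.+1) bailey_inverse (i + m) (i + t) * bailey_matrix (i + t) i
  = (m == 0%N)%:R.
Proof.
under eq_bigr do rewrite bailey_inverse_term.
rewrite -mulr_sumr; case: m => [|m]; last first.
  rewrite bressoud_sum ?mulr0 ?mulf_neq0 ?invr_eq0 // => n.
    by rewrite mulrAC qpoch_shift_neq0.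
  by rewrite mulf_div_shift mulrAC qpoch_shift_neq0.
rewrite big_ord1 /bressoud_term !qpoch0 !addn0 muln0 subn0 !expr0.
rewrite !mulr1 invr1 mulr1 mulf_div_shift.
(* For the diagonal entry, a factor of a factorial of length [2 * i + 1] is peeled off at either
   end, so that the quotient is 1. *)
have heS := qpochSl q e (2 * i); have hcS := qpochSl q c (2 * i).
rewrite !qpochS in heS hcS.
transitivity ((qpoch q e (2 * i) * (1 - e * q ^+ (2 * i)))
    * (qpoch q c (2 * i) * (1 - c * q ^+ (2 * i)))
  / ((1 - e) * qpoch q (e * q) (2 * i) * ((1 - c) * qpoch q (c * q) (2 * i)))).
  by field; rewrite hc he c1 e1.
by rewrite heS hcS divff // !mulf_neq0.
Qed.

Lemma bailey_inversion (alpha beta : nat -> F) :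
  bailey_relation q e c alpha beta ->
  forall n, alpha n = \sum_(j < n.+1) bailey_inverse n j * beta j.
Proof.
move=> hrel n; under eq_bigr do rewrite hrel mulr_sumr.
(* The middle index is written [i + t], so that exchanging the sums gives, for each [i], the
   orthogonality sum with [m = n - i]; only [i = n] survives. *)
pose f i t := bailey_inverse n (i + t) * bailey_matrix (i + t) i * alpha i.
transitivity (\sum_(j < n.+1) \sum_(i < j.+1) f i (j - i)%N); last first.
  apply: eq_bigr => j _; apply: eq_bigr => i _.
  by rewrite /f subnKC -?mulrA // -ltnS.
rewrite -big_triangle big_ord_recr /= subnn big_ord1 big1 => [|i _].
  have := bailey_inverseK n 0; rewrite big_ord1 !addn0 eqxx /f addn0 => ->.
  by rewrite mul1r add0r.
have lein : (i <= n)%N by rewrite ltnW.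
have := bailey_inverseK i (n - i); rewrite subnKC // -mulr_suml => ->.
by rewrite subn_eq0 leqNgt ltn_ord mul0r.
Qed.
End Inversion.

(** * The coefficients of [beta'] and the conclusion *)

(** Reversal with [x = a / k] turns the two factorials with negative powers of [q] into ones of
    length [n - j - r] and uses up [(q * a / k) ^+ r]; the remaining [(c / e) ^+ r] belongs to
    [bailey_inverse]. The other factorials merge by concatenation. *)
Lemma beta'_coefficient (F : fieldType) (q a k c e : F) (n j r : nat) :
  q != 0 -> (forall i, qpoch q q i != 0) ->
  c != 0 -> e != 0 -> k != 0 -> a != 0 -> 1 - c != 0 -> 1 - e != 0 ->
  1 - e * q ^+ (2 * j) != 0 ->
  (forall i, qpoch q (c * q) i != 0) -> (forall i, qpoch q (a * q) i != 0) ->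
  (forall N i, (i <= N)%N -> qpoch q (a * q ^ (1 - N%:Z) / k) i != 0) ->
  (r <= n - j)%N ->
  (1 - c * q ^+ (2 * j)) * qpoch q (k / a) (n - j) * qpoch q k (n + j)
    * qpoch q (e * q) (2 * j)
  / ((1 - c) * qpoch q q (n - j) * qpoch q (a * q) (n + j)
     * qpoch q (c * q) (2 * j))
  * ((1 - e * q ^+ (2 * j + 2 * r))
       * qpochs q [:: q ^- (n - j); k * q ^+ (n + j); e / c; e * q ^+ (2 * j)] r
     / ((1 - e * q ^+ (2 * j))
        * qpochs q [:: a * q ^+ (n + j + 1); a * q ^ (1 - (n - j)%N%:Z) / k;
                       c * q ^+ (2 * j + 1); q] r)
     * (q * a * c / (k * e)) ^+ r)
  = bailey_inverse q c e (j + r) j * bailey_matrix q k a n (j + r).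
Proof.
move=> q0 hq c0 e0 k0 a0 c1 e1 he1 hc ha hak lern.
have hrev := qpoch_rev_ratio q0 (mulf_neq0 a0 (invr_neq0 k0)) lern.
rewrite (mulrAC a) invf_div in hrev.
have heS := qpochSl q e (2 * j); rewrite qpochS in heS.
have hD := hak (n - j)%N r lern.
rewrite /bailey_inverse /bailey_matrix /qpochs !big_cons !big_nil addKn.
set D := qpoch q (a * _ / k) r in hrev hD *.
have -> : (n - (j + r) = n - j - r)%N by rewrite subnDA.
have -> : (j + r + j = 2 * j + r)%N by rewrite addnAC addnn mul2n.
rewrite !(addnA n) !(qpochD _ _ (n + j)) !(qpochD _ _ (2 * j)) mulnDr.
have -> : qpoch q (k / a) (n - j - r)
    = qpoch q (q ^- (n - j)) r * qpoch q q (n - j - r) * qpoch q (k / a) (n - j)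
      * (a / k * q) ^+ r / (D * qpoch q q (n - j)).
  by apply: (canRL (mulfK _)); rewrite ?mulf_neq0 // -hrev; ring.
have -> : qpoch q (e * q) (2 * j)
    = qpoch q e (2 * j) * (1 - e * q ^+ (2 * j)) / (1 - e).
  by rewrite heS mulrAC divff // mul1r.
have hcs := qpoch_shift_neq0 (2 * j) hc; have has := qpoch_shift_neq0 (n + j) ha.
have shiftE x m : x * q ^+ (m + 1) = x * q * q ^+ m by rewrite addn1 exprS mulrA.
rewrite !shiftE !exprMn !exprVn !exprMn !mulr1.
have kr : k ^+ r != 0 by rewrite expf_neq0.
have er : e ^+ r != 0 by rewrite expf_neq0.
field.
by rewrite kr er hD c1 e1 he1 !hq hc ha hcs has.
Qed.

Theorem theorem2p4 (F : fieldType) (q : F)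
    (alpha beta : F -> F -> nat -> F) (g : nat -> F) (c e : F)
    (hq0 : q != 0)
    (hq : forall n : nat, qpoch q q n != 0)
    (hc0 : c != 0) (hc1 : 1 - c != 0)
    (hc : forall n : nat, qpoch q (c * q) n != 0)
    (he : bailey_generic q e)
    (he1 : forall j : nat, 1 - e * q ^+ (2 * j) != 0)
    (hpair : forall a k : F, bailey_generic q a ->
       bailey_relation q a k (alpha a k) (beta a k)) :
  forall a k : F,
    bailey_generic q a -> k != 0 ->
    (forall N r : nat, (r <= N)%N ->
       qpoch q (a * q ^ (1 - N%:Z) / k) r != 0) ->
    bailey_relation q a k (alpha' g c e alpha a k) (beta' q g c e beta a k).
Proof.
move=> a k [a0 ha] k0 hak n; case: (he) => e0 hen.
have e1 : 1 - e != 0 by have := he1 0%N; rewrite muln0 mulr1.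
have inv := bailey_inversion hq hc0 e0 hc1 e1 hc hen (hpair e c he).
rewrite /beta' /alpha'.
pose f j r := beta e c j * (bailey_inverse q c e (j + r) j
  * bailey_matrix q k a n (j + r) * g (j + r)%N).
transitivity (\sum_(j < n.+1) \sum_(r < (n - j).+1) f j r).
  apply: eq_bigr => j _; rewrite mulr_sumr; apply: eq_bigr => r _.
  have lern : (r <= n - j)%N by rewrite -ltnS.
  rewrite /f -(beta'_coefficient hq0 hq hc0 e0 k0 a0 hc1 e1 (he1 j) hc ha hak lern).
  by rewrite (addnC j r) !mulrA.
(* For fixed [s = j + r], both [g s] and the matrix entry are free of [j]; the sum over [j] that is
   left is the inversion formula for [alpha e c s]. *)
rewrite big_triangle; apply: eq_bigr => s _.
rewrite inv !mulr_sumr; apply: eq_bigr => j _.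
have lejs : (j <= s)%N by rewrite -ltnS.
by rewrite /f subnKC // /bailey_matrix; ring.
Qed.
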